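(* For any $w\in F$ and any fixed $r,s\in\mathbb{R}$, the set $X(w,r,s)$ is a compact interval, with maximum $R(w,r,s)$ and minimum $-R(w,-r,-s)$.
   Context: $F$ is the free group on two generators $a,b$. $\mathrm{Homeo}^+(S^1)^\sim$ denotes the group of increasing homeomorphisms of $\mathbb{R}$ commuting with $x\mapsto x+1$ (lifts of orientation-preserving homeomorphisms of $S^1=\mathbb{R}/\mathbb{Z}$), and $\mathrm{rot}^\sim(\varphi)=\lim_{n\to\infty}(\varphi^n(x)-x)/n\in\mathbb{R}$ is the real-valued Poincaré rotation number. For $w\in F$ and $r,s\in\mathbb{R}$, $X(w,r,s)\subset\mathbb{R}$ denotes the set of values of $\mathrm{rot}^\sim(\rho(w))$ over all homomorphisms $\rho:F\to \mathrm{Homeo}^+(S^1)^\sim$ with $\mathrm{rot}^\sim(\rho(a))=r$ and $\mathrm{rot}^\sim(\rho(b))=s$, and $R(w,r,s)=\sup X(w,r,s)$. *)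

(* Defs.v *)
From HB Require Import structures.
From mathcomp Require Import all_boot all_order all_algebra.
From mathcomp Require Import all_classical all_reals all_analysis.
From mathcomp Require Import ring lra.

Set Implicit Arguments.
Unset Strict Implicit.
Unset Printing Implicit Defensive.

Import Order.TTheory GRing.Theory Num.Theory.
Import numFieldNormedType.Exports.

(* The free group on two generators, realized as the group of reduced words.
   A letter (g, e) is the generator a (g = false) or b (g = true), inverted
   when e = true. *)
Definition letter : Type := (bool * bool)%type.
Definition linv (x : letter) : letter := (x.1, ~~ x.2).
Definition reduced (u : seq letter) : bool :=
  sorted (fun x y => y != linv x) u.

Record free2 := Free2 { word :> seq letter; _ : reduced word }.
HB.instance Definition _ := [isSub for word].
HB.instance Definition _ := [Countable of free2 by <:].

(* Left multiplication of a reduced word by a letter, and by a word. *)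
Definition lcons (x : letter) (u : seq letter) : seq letter :=
  if u is y :: t then if y == linv x then t else x :: u else [:: x].
Definition wmul (u v : seq letter) : seq letter := foldr lcons v u.
Definition winv (u : seq letter) : seq letter := rev (map linv u).

Lemma linvK : involutive linv.
Proof. by case=> g e; rewrite /linv /= negbK. Qed.

Lemma reduced_lcons x u : reduced u -> reduced (lcons x u).
Proof.
case: u => [//|y t] /= red_t; case: ifP => [_|/negbT nyx] /=.
  exact: path_sorted red_t.
by rewrite nyx.
Qed.

Lemma lconsK x u : reduced u -> lcons (linv x) (lcons x u) = u.
Proof.
case: u => [_|y t] /=; first by rewrite linvK eqxx.
case: eqP => [-> |_ _] /=; last by rewrite linvK eqxx.
case: t => [//|z t] /= /andP[/negbTE nz _].
by rewrite nz.
Qed.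

Lemma reduced_wmul u v : reduced v -> reduced (wmul u v).
Proof. by move=> rv; elim: u => //= x u IHu; apply: reduced_lcons. Qed.

Lemma wmul_lcons x u v : reduced v -> wmul (lcons x u) v = lcons x (wmul u v).
Proof.
move=> rv; case: u => [//|y t] /=; case: eqP => [-> |//].
by have /= := lconsK (linv x) (reduced_wmul t rv); rewrite linvK => ->.
Qed.

Lemma wmulA u v w : reduced w -> wmul (wmul u v) w = wmul u (wmul v w).
Proof. by move=> rw; elim: u => //= x u IHu; rewrite wmul_lcons // IHu. Qed.

Lemma wmul0 u : reduced u -> wmul u [::] = u.
Proof.
elim: u => [//|x u IHu] rxu; have ru : reduced u := path_sorted rxu.
by rewrite /= (IHu ru); case: u rxu {IHu ru} => //= y u /andP[/negbTE ->].
Qed.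

Lemma reduced_winv u : reduced u -> reduced (winv u).
Proof.
rewrite /winv /reduced rev_sorted sorted_map; apply: sub_sorted => x y /=.
by rewrite linvK eq_sym.
Qed.

Lemma wmulVw u : wmul (winv u) u = [::].
Proof.
elim: u => //= x u; rewrite /winv /= rev_cons -cats1 /wmul foldr_cat /=.
by rewrite linvK eqxx.
Qed.

Lemma winvK : involutive winv.
Proof.
move=> u; rewrite /winv map_rev revK -map_comp -[RHS]map_id.
by apply: eq_map => x /=; rewrite linvK.
Qed.

Section Free2Group.
Implicit Types u v w : free2.

Lemma free2P u : reduced u. Proof. by case: u. Qed.

Definition free2_one : free2 := @Free2 [::] isT.
Definition free2_mul u v : free2 := Free2 (reduced_wmul u (free2P v)).
Definition free2_inv u : free2 := Free2 (reduced_winv (free2P u)).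

Fact free2_mulA : associative free2_mul.
Proof. by move=> u v w; apply: val_inj; rewrite /= wmulA // free2P. Qed.
Fact free2_mul1 : left_id free2_one free2_mul.
Proof. by move=> u; apply: val_inj. Qed.
Fact free2_1mul : right_id free2_one free2_mul.
Proof. by move=> u; apply: val_inj; rewrite /= wmul0 // free2P. Qed.
Fact free2_mulV : left_inverse free2_one free2_inv free2_mul.
Proof. by move=> u; apply: val_inj; rewrite /= wmulVw. Qed.
Fact free2_Vmul : right_inverse free2_one free2_inv free2_mul.
Proof.
by move=> u; apply: val_inj; rewrite /= -{1}(winvK u) wmulVw.
Qed.

HB.instance Definition _ := isGroup.Build free2 free2_mulA free2_mul1
  free2_1mul free2_mulV free2_Vmul.
End Free2Group.

Definition gen_a : free2 := @Free2 [:: (false, false)] isT.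
Definition gen_b : free2 := @Free2 [:: (true, false)] isT.

Section Free2Universal.
Local Open Scope group_scope.
Variables (G : groupType) (g h : G).

Definition letter_eval (x : letter) : G :=
  let y := if x.1 then h else g in if x.2 then y^-1 else y.
Definition word_eval (u : seq letter) : G :=
  foldr (fun x y => letter_eval x * y) 1 u.

Lemma letter_evalV x : letter_eval (linv x) = (letter_eval x)^-1.
Proof. by case: x => [[] []]; rewrite /letter_eval /= ?invgK. Qed.

Lemma word_eval_lcons x u : word_eval (lcons x u) = letter_eval x * word_eval u.
Proof.
case: u => [//|y t] /=; case: eqP => [-> |//].
by rewrite letter_evalV mulgA mulgV mul1g.
Qed.

Definition free2_eval (u : free2) : G := word_eval u.

Fact free2_evalM : {morph free2_eval : u v / u * v}.
Proof.
case=> u ru v; rewrite /free2_eval /=.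
elim: u {ru} => [|x u IHu] /=; first by rewrite mul1g.
by rewrite word_eval_lcons IHu mulgA.
Qed.

HB.instance Definition _ := isMultiplicative.Build free2 G free2_eval
  free2_evalM.

Theorem free2_universal :
  exists2 rho : {multiplicative free2 -> G},
    rho gen_a = g /\ rho gen_b = h &
    forall rho' : {multiplicative free2 -> G},
      rho' gen_a = g -> rho' gen_b = h -> rho' =1 rho.
Proof.
exists (free2_eval : {multiplicative free2 -> G}).
  by split; rewrite /= /free2_eval /= /letter_eval /= mulg1.
move=> rho' ra rb.
have r1 : rho' 1 = 1 by apply: (mulgI (rho' 1)); rewrite -gmulfM !mulg1.
have rV u : rho' u^-1 = (rho' u)^-1.
  by apply: (mulgI (rho' u)); rewrite -gmulfM !mulgV r1.
case=> u; rewrite /= /free2_eval /=; elim: u => [|x u IHu] rxu /=.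
  by apply: etrans r1; congr (rho' _); apply: val_inj.
have ru : reduced u := path_sorted rxu.
rewrite -(IHu ru : _ = word_eval u).
have rx : rho' (@Free2 [:: x] isT) = letter_eval x.
  case: x {rxu} => [[] []]; rewrite /letter_eval /= -?ra -?rb -?rV;
  by congr (rho' _); apply: val_inj.
rewrite -rx -gmulfM; congr (rho' _); apply: val_inj => /=.
by case: u rxu {IHu ru rx} => //= y u /andP[/negbTE ->].
Qed.

End Free2Universal.

Section Lift.
Local Open Scope ring_scope.
Local Open Scope classical_set_scope.
Variable R : realType.

(* The group Homeo^+(S^1)^~ of increasing homeomorphisms of R commuting with
   x |-> x + 1. *)
Record lift_homeo := LiftHomeo {
  lift_fun :> R -> R;
  lift_inv : R -> R;
  lift_funK : cancel lift_fun lift_inv;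
  lift_invK : cancel lift_inv lift_fun;
  lift_fun_continuous : continuous lift_fun;
  lift_inv_continuous : continuous lift_inv;
  lift_fun_lt : {homo lift_fun : x y / x < y};
  lift_fun1 : forall x, lift_fun (x + 1) = lift_fun x + 1
}.

HB.instance Definition _ := gen_eqMixin lift_homeo.
HB.instance Definition _ := gen_choiceMixin lift_homeo.

Lemma lift_homeoP (f g : lift_homeo) : f =1 g -> f = g.
Proof.
move=> fg; have fgE : lift_fun f = lift_fun g by apply: funext.
have fgV : lift_inv f = lift_inv g.
  by apply: funext => x; rewrite -[x in LHS](lift_invK g) -fg lift_funK.
case: f fgE fgV {fg} => f f' fK f'K cf cf' lf f1 /= fgE fgV.
subst f f'; case: g fK f'K cf cf' lf f1 => g g' /= *.
by congr LiftHomeo; apply: Prop_irrelevance.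
Qed.

Definition lift_one : lift_homeo.
Proof.
by apply: (@LiftHomeo id id) => // x; apply: cvg_id.
Defined.

Definition lift_mul (f g : lift_homeo) : lift_homeo.
Proof.
apply: (@LiftHomeo (f \o g) (lift_inv g \o lift_inv f)).
- exact: can_comp (lift_funK f) (lift_funK g).
- exact: can_comp (lift_invK g) (lift_invK f).
- move=> x; apply: continuous_comp; exact: lift_fun_continuous.
- move=> x; apply: continuous_comp; exact: lift_inv_continuous.
- by move=> x y xy /=; do 2 apply: lift_fun_lt.
- by move=> x /=; rewrite !lift_fun1.
Defined.

Definition lift_opp (f : lift_homeo) : lift_homeo.
Proof.
apply: (@LiftHomeo (lift_inv f) f).
- exact: lift_invK.
- exact: lift_funK.
- exact: lift_inv_continuous.
- exact: lift_fun_continuous.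
- move=> x y xy; rewrite ltNge; apply/negP => yx.
  move: xy; rewrite ltNge => /negP; apply.
  by rewrite -(lift_invK f x) -(lift_invK f y) (ltW_homo (@lift_fun_lt f)).
- by move=> x; apply: (can_inj (lift_funK f)); rewrite lift_fun1 !lift_invK.
Defined.

Fact lift_mulA : associative lift_mul.
Proof. by move=> f g h; apply: lift_homeoP. Qed.
Fact lift_mul1 : left_id lift_one lift_mul.
Proof. by move=> f; apply: lift_homeoP. Qed.
Fact lift_1mul : right_id lift_one lift_mul.
Proof. by move=> f; apply: lift_homeoP. Qed.
Fact lift_mulV : left_inverse lift_one lift_opp lift_mul.
Proof. by move=> f; apply: lift_homeoP => x /=; rewrite lift_funK. Qed.
Fact lift_Vmul : right_inverse lift_one lift_opp lift_mul.
Proof. by move=> f; apply: lift_homeoP => x /=; rewrite lift_invK. Qed.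

HB.instance Definition _ := isGroup.Build lift_homeo lift_mulA lift_mul1
  lift_1mul lift_mulV lift_Vmul.

(* The limit exists and does not depend on the base point 0: see rot_cvg. *)
Definition rot (f : lift_homeo) : R :=
  limn (fun n : nat => (iter n f 0 - 0) / n%:R).

Section RotCvg.
Variable f : lift_homeo.

Lemma lift_iter_le n : {homo iter n f : x y / x <= y}.
Proof.
by elim: n => //= n IHn x y /IHn; apply: (ltW_homo (@lift_fun_lt f)).
Qed.

Lemma lift_iter1 n x : iter n f (x + 1) = iter n f x + 1.
Proof. by elim: n => //= n ->; rewrite lift_fun1. Qed.

Lemma lift_iter_int n x (k : int) : iter n f (x + k%:~R) = iter n f x + k%:~R.
Proof.
have natP (m : nat) y : iter n f (y + m%:R) = iter n f y + m%:R.
  by elim: m => [|m IHm]; rewrite ?addr0 // -natr1 !addrA lift_iter1 IHm.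
case: (intP k) => [|m|m]; rewrite ?addr0 ?natP // mulrNz.
by rewrite -[X in _ = iter n f X - _](subrK m.+1%:R x) natP addrK.
Qed.

Lemma lift_iter_dist n x y :
  `|(iter n f x - x) - (iter n f y - y)| <= 1.
Proof.
have /andP[] := floor_itv (x - y); rewrite intrD1.
set k := (Num.floor _)%:~R => kl kr.
have h1 : iter n f y + k <= iter n f x.
  by rewrite -lift_iter_int; apply: lift_iter_le; rewrite -/k; lra.
have h2 : iter n f x <= iter n f y + k + 1.
  by rewrite -lift_iter_int -lift_iter1; apply: lift_iter_le; rewrite -/k; lra.
by rewrite ler_norml; apply/andP; split; lra.
Qed.

Lemma lift_iter_mul k m x :
  `|(iter (k * m) f x - x) - k%:R * (iter m f x - x)| <= k%:R.
Proof.
elim: k => [|k IHk]; first by rewrite mul0n /= mul0r !subrr normr0.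
have := lift_iter_dist m (iter (k * m) f x) x.
rewrite mulSn iterD -natr1 mulrDl mul1r.
move: IHk; rewrite !ler_norml => /andP[? ?] /andP[? ?].
by apply/andP; split; lra.
Qed.

Lemma rot_seq_dist (m n : nat) x :
  `|(iter m.+1 f x - x) / m.+1%:R - (iter n.+1 f x - x) / n.+1%:R|
    <= m.+1%:R^-1 + n.+1%:R^-1.
Proof.
have m0 : 0 < m.+1%:R :> R by [].
have n0 : 0 < n.+1%:R :> R by [].
have := lift_iter_mul n.+1 m.+1 x; have := lift_iter_mul m.+1 n.+1 x.
rewrite [(n.+1 * _)%N]mulnC.
set A := iter (_ * _) _ _ - _; set P := iter m.+1 f x - x.
set Q := iter n.+1 f x - x; set M := m.+1%:R in m0 *; set N := n.+1%:R in n0 *.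
move=> h1 h2.
have MN : 0 < M * N by rewrite mulr_gt0.
have -> : P / M - Q / N = (N * P - M * Q) / (M * N) by field; rewrite !gt_eqF.
have -> : M^-1 + N^-1 = (M + N) / (M * N) by field; rewrite !gt_eqF.
rewrite normrM normfV (gtr0_norm MN) ler_pM2r ?invr_gt0 //.
move: h1 h2; rewrite !ler_norml => /andP[? ?] /andP[? ?].
by apply/andP; split; lra.
Qed.

Lemma rot_seq_is_cvg x : cvgn (fun n : nat => (iter n f x - x) / n%:R).
Proof.
set u : R^nat := (fun n => _).
suff /cvg_ex[l ul] : cvgn [sequence u n.+1]_n.
  by apply/cvg_ex; exists l; rewrite -cvg_shiftS.
apply/cauchy_cvgP/cauchy_exP => e e0.
have e2 : 0 < e / 2 by lra.
have /cvgrPdist_lt/(_ _ e2)[N _ HN] := @cvg_harmonic R.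
exists ((iter N.+1 f x - x) / N.+1%:R); exists N => // n Nn /=.
apply: le_lt_trans (rot_seq_dist N n x) _.
have := HN N (leqnn N); have := HN n Nn; rewrite /harmonic /= !sub0r !normrN.
by rewrite !ger0_norm // => hn hN; rewrite (splitr e) ltrD.
Qed.

Theorem rot_cvg x : (iter n f x - x) / n%:R @[n --> \oo] --> rot f.
Proof.
have r0 : (iter n f 0 - 0) / n%:R @[n --> \oo] --> rot f :=
  @rot_seq_is_cvg 0.
apply: cvg_sub0 r0.
rewrite -cvg_shiftS; apply: norm_cvg0.
apply: (@squeeze_cvgr _ _ _ _ (cst 0) harmonic); last 2 first.
- exact: cvg_cst.
- exact: cvg_harmonic.
apply: nearW => n; rewrite normr_ge0 /=.
rewrite /harmonic /= !fctE -mulrBl normrM (ger0_norm (x := _^-1)) //.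
by rewrite -[leRHS]mul1r ler_pM2r ?invr_gt0 // (lift_iter_dist n.+1 x 0).
Qed.

End RotCvg.

Definition rot_set (w : free2) (r s : R) : set R :=
  [set rot (rho w) | rho in
    [set rho : {multiplicative free2 -> lift_homeo} |
      rot (rho gen_a) = r /\ rot (rho gen_b) = s]].

Definition rot_sup (w : free2) (r s : R) : R := sup (rot_set w r s).

End Lift.

(* Main.v *)
From mathcomp Require Import all_boot all_order all_algebra.
From mathcomp Require Import all_classical all_reals all_analysis.
From mathcomp Require Import ring lra.
Require Import Defs.

Set Implicit Arguments.
Unset Strict Implicit.
Unset Printing Implicit Defensive.

Import Order.TTheory GRing.Theory Num.Theory.
Import numFieldNormedType.Exports.
Local Open Scope ring_scope.
Local Open Scope classical_set_scope.

(** Pointwise convergence makes the group of lifts a topological group on which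
the rotation number is continuous.

Connectedness: the lifts with a given rotation number are path connected, because
the largest constant [c] for which [x |-> f x + c] has rotation number at most [r]
is 1-Lipschitz in [f] for the uniform distance; this lets one correct the straight
line from [f] to the identity.

Compactness: any finite family of lifts can be conjugated simultaneously to lifts
with a Lipschitz constant that depends only on the size of the family. Conjugation
preserves rotation numbers, so the generators may be taken uniformly
bi-Lipschitz, and limits of such lifts along an ultrafilter are again lifts.

The minimum follows from the maximum by conjugating with [x |-> - x]. *)

(** * Lifts, their rotation numbers and homomorphisms from the free group *)

Section Lifts.
Variable R : realType.
Implicit Types (f g h : lift_homeo R) (x y : R).

Lemma lift_mono f : {mono f : x y / x <= y}.
Proof. exact/le_mono/lift_fun_lt. Qed.

Lemma lift_monoS f : {mono f : x y / x < y}.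
Proof. exact/leW_mono/lift_mono. Qed.

Lemma lift_mulE f g x : (f * g)%g x = f (g x).
Proof. by []. Qed.

Lemma lift_mulVK f : cancel f (f^-1)%g.
Proof. exact: lift_funK. Qed.

Lemma lift_mulKV f : cancel (f^-1)%g f.
Proof. exact: lift_invK. Qed.

Lemma deg1_int (f : R -> R) (k : int) x :
  (forall y, f (y + 1) = f y + 1) -> f (x + k%:~R) = f x + k%:~R.
Proof.
move=> f1; have natP (m : nat) y : f (y + m%:R) = f y + m%:R.
  by elim: m => [|m IHm]; rewrite ?addr0 // -natr1 !addrA f1 IHm.
case: (intP k) => [|m|m]; rewrite ?addr0 ?natP // mulrNz.
by rewrite -[X in _ = f X - _](subrK m.+1%:R x) natP addrK.
Qed.

(** Commutation with integer translations traps every [y] between the values of [f] at two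
    consecutive integers, so the intermediate value theorem gives surjectivity; the order makes the
    inverse continuous. *)
Lemma ex_lift_homeo (f : R -> R) : continuous f -> {homo f : x y / x < y} ->
  (forall x, f (x + 1) = f x + 1) -> exists g, g =1 f :> (R -> R).
Proof.
move=> cf lf f1.
have mf : {mono f : x y / x <= y} by exact/le_mono.
have surj y : exists x, f x = y.
  pose k : R := (Num.floor (y - f 0))%:~R.
  have /andP[kl kr] := floor_itv (y - f 0); rewrite intrD1 -/k in kr.
  rewrite -/k in kl.
  have fk : f k = f 0 + k by rewrite -[k in LHS]add0r deg1_int.
  have kk : k <= k + 1 by lra.
  have [||x _ <-] := @IVT R f k (k + 1) y kk; last by exists x.
    exact: continuous_subspaceT.
  by rewrite f1 fk; apply/andP; split; rewrite ?ge_min ?le_max; apply/orP;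
    [left|right]; lra.
have [g gK] := choice surj.
have fK : cancel f g by move=> x; apply: (inc_inj mf); rewrite gK.
have cg : continuous g.
  move=> y; apply/cvgrPdist_lt => e e0.
  have ly : f (g y - e) < y by rewrite -[ltRHS]gK lf //; lra.
  have ry : y < f (g y + e) by rewrite -[ltLHS]gK lf //; lra.
  near=> z.
  have lz : f (g y - e) < z by near: z; exact: lt_nbhsr.
  have rz : z < f (g y + e) by near: z; exact: lt_nbhsl.
  rewrite -[z]gK !(leW_mono mf) in lz rz.
  by rewrite ltr_norml; apply/andP; split; lra.
by exists (LiftHomeo fK gK cf cg lf f1).
Unshelve. all: by end_near.
Qed.

Lemma lift_displacement f x y : `|(f x - x) - (f y - y)| <= 1.
Proof. exact: (lift_iter_dist f 1). Qed.

(** Let [m] tend to infinity in [rot_seq_dist]. The rate is the same for all lifts, which is what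
    makes [rot] continuous. *)
Lemma rot_dist f n : `|rot f - iter n.+1 f 0 / n.+1%:R| <= n.+1%:R^-1.
Proof.
have h := @rot_cvg _ f 0; rewrite -cvg_shiftS in h.
have h1 : `|(iter m.+1 f 0 - 0) / m.+1%:R - iter n.+1 f 0 / n.+1%:R|
   @[m --> \oo] --> `|rot f - iter n.+1 f 0 / n.+1%:R|.
  by apply: cvg_norm; apply: cvgB => //; exact: cvg_cst.
have h2 : (m.+1%:R^-1 + n.+1%:R^-1 : R) @[m --> \oo] --> (0 + n.+1%:R^-1 : R).
  by apply: cvgD; [exact: cvg_harmonic|exact: cvg_cst].
rewrite add0r in h2; apply: (ler_cvg_to h1 h2).
by apply: nearW => m; have := rot_seq_dist f m n 0; rewrite !subr0.
Qed.

Lemma rot_eq_bounded f g (C : R) :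
  (forall n, `|iter n f 0 - iter n g 0| <= C) -> rot f = rot g.
Proof.
move=> fg; apply/eqP; rewrite -subr_eq0 -normr_le0.
have h : ((C + 2) * n.+1%:R^-1 : R) @[n --> \oo] --> ((C + 2) * 0 : R).
  by apply: cvgMr; exact: cvg_harmonic.
rewrite mulr0 in h.
apply: (ler_cvg_to (cvg_cst `|rot f - rot g|) h); apply: nearW => n; cbv beta.
have := rot_dist f n; have := rot_dist g n.
have : `|iter n.+1 f 0 / n.+1%:R - iter n.+1 g 0 / n.+1%:R| <= C * n.+1%:R^-1.
  rewrite -mulrBl normrM [X in _ * X]ger0_norm ?invr_ge0 //.
  by rewrite ler_wpM2r ?invr_ge0.
set i := n.+1%:R^-1; rewrite mulrDl.
rewrite !ler_norml => /andP[? ?] /andP[? ?] /andP[? ?].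
by apply/andP; split; lra.
Qed.

Lemma le_rot f g : (forall x, f x <= g x) -> rot f <= rot g.
Proof.
move=> fg; have hf := @rot_cvg _ f 0; have hg := @rot_cvg _ g 0.
refine (ler_cvg_to hf hg _).
apply: nearW => n; rewrite !subr0 ler_wpM2r ?invr_ge0 //.
elim: n => //= n IHn; apply: le_trans (fg _) _; by rewrite lift_mono.
Qed.

(** The orbit of 0 under the conjugate is the image under [h] of the [f]-orbit of [lift_inv h 0].
    Applying [h] and changing the base point both cost a bounded amount. *)
Lemma rot_conj f h : rot (h * f * h^-1)%g = rot f.
Proof.
apply: (@rot_eq_bounded _ _ (`|h (lift_inv h 0) - lift_inv h 0| + 2)) => n.
have -> : iter n (h * f * h^-1)%g 0 = h (iter n f (lift_inv h 0)).
  elim: n => [|n IHn] /=; first by rewrite lift_invK.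
  by rewrite IHn lift_funK.
set z := lift_inv h 0.
have := lift_displacement h (iter n f z) z.
have := lift_iter_dist f n z 0.
have hz : h z = 0 by exact: lift_invK.
rewrite hz sub0r normrN.
have := ler_norm z; have := ler_norm (- z); rewrite normrN => ? ?.
rewrite !ler_norml => /andP[? ?] /andP[? ?].
by apply/andP; split; lra.
Qed.

Lemma rot_displacement f x : `|f x - x| <= `|rot f| + 2.
Proof.
have := lift_displacement f x 0; have := rot_dist f 0.
rewrite /= invr1 mulr1.
have := ler_norm (rot f); have := ler_norm (- (rot f)); rewrite normrN.
by rewrite !ler_norml => ? ? /andP[? ?] /andP[? ?]; apply/andP; split; lra.
Qed.

(** * Pointwise convergence of lifts along a filter *)

Section PointwiseConvergence.
Context {T : Type} {F : set_system T} {FF : Filter F}.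
Implicit Types (u v : T -> lift_homeo R).

Definition lcvg u f := forall x, u t x @[t --> F] --> f x.

(* Monotonicity upgrades pointwise convergence to continuous convergence, which
   is what makes it compatible with composition. *)
Lemma lcvg_app u f (z : T -> R) x :
  lcvg u f -> z t @[t --> F] --> x -> u t (z t) @[t --> F] --> f x.
Proof.
move=> uf zx; apply/cvgrPdist_lt => e e0.
have e2 : 0 < e / 2 by lra.
have /cvgrPdist_lt/(_ _ e2)/nbhs_ballP[d d0 /= fd] := @lift_fun_continuous _ f x.
rewrite /= in d0; pose d' := d / 2; have d'0 : 0 < d' by rewrite /d'; lra.
have fl : `|f x - f (x - d')| < e / 2.
  by apply: fd; rewrite /ball /= opprB addrC subrK gtr0_norm // /d'; lra.
have fr : `|f x - f (x + d')| < e / 2.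
  apply: fd; rewrite /ball /= opprD addrA subrr add0r normrN gtr0_norm //.
  by rewrite /d'; lra.
near=> t.
have zt : `|x - z t| < d' by near: t; move/cvgrPdist_lt: zx; exact.
have ul : `|f (x - d') - u t (x - d')| < e / 2.
  by near: t; move/cvgrPdist_lt: (uf (x - d')); exact.
have ur : `|f (x + d') - u t (x + d')| < e / 2.
  by near: t; move/cvgrPdist_lt: (uf (x + d')); exact.
move: zt; rewrite ltr_norml => /andP[zl zr].
have l1 : u t (x - d') <= u t (z t) by rewrite lift_mono; lra.
have l2 : u t (z t) <= u t (x + d') by rewrite lift_mono; lra.
move: fl fr ul ur; rewrite !ltr_norml => /andP[? ?] /andP[? ?] /andP[? ?] /andP[? ?].
by apply/andP; split; lra.
Unshelve. all: by end_near.
Qed.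

Lemma lcvg_cst f : lcvg (fun=> f) f.
Proof. by move=> x; exact: cvg_cst. Qed.

Lemma lcvgM u v f g : lcvg u f -> lcvg v g -> lcvg (fun t => u t * v t)%g (f * g)%g.
Proof. by move=> uf vg x; exact (lcvg_app uf (vg x)). Qed.

(** Convergence at the two points [y - e] and [y + e] suffices: eventually [u t] sends them to
    opposite sides of [x], which traps the preimage of [x]. *)
Lemma lcvgV u f : lcvg u f -> lcvg (fun t => (u t)^-1)%g (f^-1)%g.
Proof.
move=> uf x; apply/cvgrPdist_lt => e e0; set y := (f^-1)%g x.
have fy : f y = x by exact: lift_mulKV.
have ly : f (y - e) < x by rewrite -fy lift_monoS; lra.
have ry : x < f (y + e) by rewrite -fy lift_monoS; lra.
near=> t.
have lt' : u t (y - e) < x by near: t; exact: (cvgr_lt _ (uf _)).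
have rt : x < u t (y + e) by near: t; exact: (cvgr_gt _ (uf _)).
rewrite -(lift_mulKV (u t) x) !lift_monoS in lt' rt.
by rewrite ltr_norml; apply/andP; split; lra.
Unshelve. all: by end_near.
Qed.

Lemma lcvg_iter u f n x : lcvg u f -> iter n (u t) x @[t --> F] --> iter n f x.
Proof.
by move=> uf; elim: n => [|n IHn] /=; [exact: cvg_cst|exact: lcvg_app].
Qed.

(** By [rot_dist] one fixed iterate approximates all the rotation numbers at once, and a fixed
    iterate converges. *)
Lemma lcvg_rot u f : lcvg u f -> rot (u t) @[t --> F] --> rot f.
Proof.
move=> uf; apply/cvgrPdist_lt => e e0.
have e3 : 0 < e / 3 by lra.
have /cvgrPdist_lt/(_ _ e3)[n _ /(_ n (leqnn n))] := @cvg_harmonic R.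
rewrite /harmonic /= sub0r normrN ger0_norm ?invr_ge0 // => ne.
have h : iter n.+1 (u t) 0 / n.+1%:R @[t --> F] --> iter n.+1 f 0 / n.+1%:R.
  by apply: cvgMl; exact: lcvg_iter.
near=> t.
have : `|iter n.+1 f 0 / n.+1%:R - iter n.+1 (u t) 0 / n.+1%:R| < e / 3.
  by near: t; move/cvgrPdist_lt: h; exact.
have := rot_dist f n; have := rot_dist (u t) n.
move: ne; set i := n.+1%:R^-1 => ne.
rewrite !ler_norml !ltr_norml => /andP[? ?] /andP[? ?] /andP[? ?].
by apply/andP; split; lra.
Unshelve. all: by end_near.
Qed.

Lemma lcvg_free2_eval u v f g (w : free2) : lcvg u f -> lcvg v g ->
  lcvg (fun t => free2_eval (u t) (v t) w) (free2_eval f g w).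
Proof.
move=> uf vg; rewrite /free2_eval.
elim: (word w) => [|x s IHs] /=; first exact: lcvg_cst.
apply: lcvgM => //; rewrite /letter_eval.
by case: x => [[] []] /=; try exact: lcvgV.
Qed.

End PointwiseConvergence.

(** By the universal property of the free group, homomorphisms correspond to pairs of lifts. *)
Lemma rot_setP (w : free2) (r s v : R) : rot_set w r s v <->
  exists f g, [/\ rot f = r, rot g = s & rot (free2_eval f g w) = v].
Proof.
split=> [[rho [ra rb] <-]|[f [g [rf rg <-]]]].
  exists (rho gen_a), (rho gen_b); split=> //; congr rot.
  have [rho' _ u] := free2_universal (rho gen_a) (rho gen_b).
  pose rho0 : {multiplicative free2 -> lift_homeo R} :=
    free2_eval (rho gen_a) (rho gen_b).
  have ua : rho0 gen_a = rho gen_a by exact: mulg1.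
  have ub : rho0 gen_b = rho gen_b by exact: mulg1.
  exact: etrans (u rho0 ua ub w) (esym (u rho erefl erefl w)).
exists (free2_eval f g : {multiplicative free2 -> lift_homeo R}) => //=.
Qed.

End Lifts.

(** * Paths of lifts with constant rotation number *)

Section Paths.
Variable R : realType.
Implicit Types (f g h : lift_homeo R) (c r x y t : R).

Fact ex_lift_add f c : exists g, forall x, g x = f x + c.
Proof.
have [x|x y xy|x|g gE] := @ex_lift_homeo R (fun x => f x + c).
- by apply: cvgD; [exact: lift_fun_continuous|exact: cvg_cst].
- by rewrite ltrD2r lift_monoS.
- by rewrite lift_fun1 addrAC.
- by exists g.
Qed.

Definition lift_add f c := projT1 (cid (ex_lift_add f c)).

Lemma lift_addE f c x : lift_add f c x = f x + c.
Proof. exact: (projT2 (cid (ex_lift_add f c))). Qed.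

Lemma lcvg_lift_add (T : Type) (F : set_system T) (FF : Filter F)
    (u : T -> lift_homeo R) (d : T -> R) f c :
  lcvg (F := F) u f -> d i @[i --> F] --> c ->
  lcvg (F := F) (fun i => lift_add (u i) (d i)) (lift_add f c).
Proof.
move=> uf dc x; rewrite lift_addE.
under eq_cvg do rewrite lift_addE.
by apply: cvgD => //; exact: uf.
Qed.

Lemma le_rot_lift_add f c d : c <= d -> rot (lift_add f c) <= rot (lift_add f d).
Proof. by move=> cd; apply: le_rot => x; rewrite !lift_addE lerD2l. Qed.

Lemma rot_lift_add_continuous f : continuous (fun c => rot (lift_add f c)).
Proof.
by move=> c; apply: lcvg_rot; apply: lcvg_lift_add; [exact: lcvg_cst|exact: cvg_id].
Qed.

Definition rot_shift f r := sup [set c | rot (lift_add f c) <= r].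

Lemma has_sup_rot_shift f r : has_sup [set c | rot (lift_add f c) <= r].
Proof.
have d0 c : `|rot (lift_add f c) - (f 0 + c)| <= 1.
  by have := rot_dist (lift_add f c) 0; rewrite /= lift_addE invr1 mulr1.
split.
  exists (r - f 0 - 1) => /=; have := d0 (r - f 0 - 1).
  by rewrite ler_norml => /andP[? ?]; lra.
exists (r + 1 - f 0) => c /=; have := d0 c.
by rewrite ler_norml => /andP[? ?] ?; lra.
Qed.

(** The rotation number of [f + c] is continuous and nondecreasing in [c], so a strict inequality at
    the supremum would persist nearby and contradict its choice. *)
Lemma rot_lift_add_shift f r : rot (lift_add f (rot_shift f r)) = r.
Proof.
set s := rot_shift f r; have hs := has_sup_rot_shift f r.
apply/eqP; rewrite eq_le; apply/andP; split; rewrite leNgt; apply/negP => sr.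
  have : nbhs s [set c | r < rot (lift_add f c)].
    exact: (cvgr_gt _ (@rot_lift_add_continuous f s)).
  move=> /nbhs_ballP[d d0 /= fd].
  rewrite /= in d0.
  have [|c /= cr cs] := @sup_adherent _ _ (d / 2) _ hs; first by lra.
  have : r < rot (lift_add f (s - d / 2)).
    by apply: fd; rewrite /ball /= opprB addrC subrK gtr0_norm; lra.
  have := @le_rot_lift_add f (s - d / 2) c (ltW cs).
  by move=> h1 h2; have := lt_le_trans h2 (le_trans h1 cr); rewrite ltxx.
have : nbhs s [set c | rot (lift_add f c) < r].
  exact: (cvgr_lt _ (@rot_lift_add_continuous f s)).
move=> /nbhs_ballP[d d0 /= fd].
rewrite /= in d0.
have : s + d / 2 <= s.
  apply: sup_upper_bound => //=; apply/ltW/fd.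
  by rewrite /ball /= opprD addrA subrr add0r normrN gtr0_norm; lra.
by lra.
Qed.

Lemma rot_shift_ge0 f : 0 <= rot_shift f (rot f).
Proof.
apply: sup_upper_bound; first exact: has_sup_rot_shift.
by apply: le_rot => x; rewrite lift_addE addr0.
Qed.

(** If [c] is admissible for [g], then [c - e] is admissible for [f], because [f + (c - e)] lies
    below [g + c]. *)
Lemma rot_shift_le f g r e : (forall x, f x <= g x + e) ->
  rot_shift g r <= rot_shift f r + e.
Proof.
move=> fg; apply: ge_sup; first by have [] := has_sup_rot_shift g r.
move=> c /= gc; rewrite -lerBlDr.
apply: sup_upper_bound; first exact: has_sup_rot_shift.
apply: le_trans gc; apply: le_rot => x; rewrite !lift_addE.
by have := fg x; lra.
Qed.

(** Truncating the parameter makes the paths total on the real line, so their continuity needs no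
    subspace. *)
Definition clamp t : R := Num.min (Num.max t 0) 1.

Lemma clamp_itv t : 0 <= clamp t <= 1.
Proof.
by rewrite /clamp le_min ge_min ler01 lexx !andbT le_max lexx !orbT.
Qed.

Lemma clamp_lipschitz t t' : `|clamp t - clamp t'| <= `|t - t'|.
Proof.
have := ler_norm (t - t'); have := ler_norm (- (t - t')); rewrite normrN => ? ?.
rewrite /clamp ler_norml; case: (leP t 0) => ?; case: (leP t' 0) => ?;
  rewrite ?(min_l ler01); try (case: (leP t 1) => ?); try (case: (leP t' 1) => ?);
  by apply/andP; split; lra.
Qed.

Lemma clamp_continuous : continuous clamp.
Proof.
move=> t; apply/cvgrPdist_lt => e e0; near=> t'.
apply: le_lt_trans (clamp_lipschitz t t') _.
by near: t'; exact: (cvgrPdist_lt _ _).1 cvg_id _ e0.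
Unshelve. all: by end_near.
Qed.

Lemma clamp_le0 t : t <= 0 -> clamp t = 0.
Proof. by move=> t0; rewrite /clamp max_r // min_l. Qed.

Lemma clamp_ge1 t : 1 <= t -> clamp t = 1.
Proof. by move=> t1; rewrite /clamp max_l ?min_r // (le_trans ler01). Qed.

Fact ex_lift_interp f t :
  exists g, forall x, g x = f x + clamp t * (x - f x).
Proof.
have /andP[t0 t1] := clamp_itv t.
have [x|x y xy|x|g gE] := @ex_lift_homeo R (fun x => f x + clamp t * (x - f x)).
- apply: cvgD; first exact: lift_fun_continuous.
  apply: cvgMr; apply: cvgB; first exact: cvg_id.
  exact: lift_fun_continuous.
- have fxy : f x < f y by rewrite lift_monoS.
  (* In the convex combination of [f] and the identity, one of the two strictly increasing terms has
     weight at least 1/2. *)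
  have [c1|c1] := leP (clamp t) (1 / 2); nra.
- by rewrite lift_fun1; lra.
- by exists g.
Qed.

Definition lift_interp f t := projT1 (cid (ex_lift_interp f t)).

Lemma lift_interpE f t x : lift_interp f t x = f x + clamp t * (x - f x).
Proof. exact: (projT2 (cid (ex_lift_interp f t))). Qed.

Lemma lift_interp_continuous f t :
  lcvg (F := nbhs t) (lift_interp f) (lift_interp f t).
Proof.
move=> x; rewrite lift_interpE; under eq_cvg do rewrite lift_interpE.
apply: cvgD; first exact: cvg_cst.
by apply: cvgMl; exact: clamp_continuous.
Qed.

Lemma rot_shift_interp_continuous f r :
  continuous (fun t => rot_shift (lift_interp f t) r).
Proof.
(* [M] bounds the displacement of [f], hence the speed at which the interpolation moves. *)
move=> t; pose M := `|rot f| + 2.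
have M0 : 0 < M by rewrite /M ltr_wpDl.
have key t1 t2 : rot_shift (lift_interp f t1) r <=
    rot_shift (lift_interp f t2) r + `|t1 - t2| * M.
  apply: rot_shift_le => x; rewrite !lift_interpE.
  have : `|(clamp t2 - clamp t1) * (x - f x)| <= `|t1 - t2| * M.
    rewrite normrM ler_pM // 1?distrC ?clamp_lipschitz //.
    exact: rot_displacement.
  by rewrite ler_norml => /andP[? ?]; lra.
apply/cvgrPdist_lt => e e0; near=> t'.
have : `|t - t'| < e / M.
  by near: t'; apply: (cvgrPdist_lt _ _).1 cvg_id _ _; rewrite divr_gt0.
rewrite ltr_pdivlMr // => tt.
have := key t t'; have := key t' t; rewrite distrC => ? ?.
by rewrite ltr_norml; apply/andP; split; lra.
Unshelve. all: by end_near.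
Qed.

(* On [-1, 0] the path adds a growing constant to [f] until the largest one that
   keeps the rotation number is reached; on [0, 1] it follows the straight line
   from [f] to the identity, corrected by that largest constant. *)
Definition rot_path f t :=
  lift_add (lift_interp f t)
    (clamp (t + 1) * rot_shift (lift_interp f t) (rot f)).

Lemma rot_path_continuous f t : lcvg (F := nbhs t) (rot_path f) (rot_path f t).
Proof.
apply: lcvg_lift_add; first exact: lift_interp_continuous.
apply: cvgM; last exact: rot_shift_interp_continuous.
apply: (@continuous_comp _ _ _ (fun t => t + 1) clamp).
  by apply: cvgD; [exact: cvg_id|exact: cvg_cst].
exact: clamp_continuous.
Qed.

Lemma rot_rot_path f t : rot (rot_path f t) = rot f.
Proof.
rewrite /rot_path; have [t0|t0] := leP 0 t.
  by rewrite clamp_ge1 ?mul1r ?rot_lift_add_shift // lerDr.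
(* For negative [t] only the added constant varies. It stays between 0 and the largest admissible
   one, and both of these give rotation number [rot f]. *)
have -> : lift_interp f t = f.
  by apply: lift_homeoP => x; rewrite lift_interpE clamp_le0 ?mul0r ?addr0 // ltW.
set s := rot_shift f (rot f).
have s0 : 0 <= s by exact: rot_shift_ge0.
have /andP[c0 c1] := clamp_itv (t + 1).
apply/eqP; rewrite eq_le; apply/andP; split.
  rewrite -[leRHS](rot_lift_add_shift f) le_rot_lift_add // -/s.
  by rewrite ler_piMl.
by apply: le_rot => x; rewrite lift_addE lerDl mulr_ge0.
Qed.

Lemma rot_path_start f : rot_path f (-1) = f.
Proof.
apply: lift_homeoP => x; rewrite lift_addE lift_interpE addNr !clamp_le0 //; lra.
Qed.

(** The end point depends on [f] only through [rot f], so all paths with the same rotation number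
    meet there. *)
Lemma rot_path_end f : rot_path f 1 = lift_add 1%g (rot_shift 1%g (rot f)).
Proof.
rewrite /rot_path.
have -> : lift_interp f 1 = 1%g.
  by apply: lift_homeoP => x; rewrite lift_interpE clamp_ge1 // mul1r addrC subrK.
by rewrite clamp_ge1 ?mul1r //; lra.
Qed.

(** The set is a union of continuous images of [[-1, 1]], one for each pair of generators, that
    share the value at the common end point. *)
Lemma is_interval_rot_set (w : free2) r s : is_interval (rot_set w r s).
Proof.
pose c r : lift_homeo R := lift_add 1%g (rot_shift 1%g r).
pose path (p : lift_homeo R * lift_homeo R) t :=
  rot (free2_eval (rot_path p.1 t) (rot_path p.2 t) w).
pose P := [set p : lift_homeo R * lift_homeo R | rot p.1 = r /\ rot p.2 = s].
have -> : rot_set w r s = \bigcup_(p in P) (path p @` `[-1, 1]).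
  apply/seteqP; split=> [v /rot_setP[f [g [rf rg <-]]]|].
    exists (f, g) => //=; exists (-1); rewrite /= ?in_itv /=; first by lra.
    by rewrite /path !rot_path_start.
  move=> _ [[f g] [/= rf rg] [t _ <-]]; apply/rot_setP.
  by exists (rot_path f t), (rot_path g t); split=> //; rewrite rot_rot_path.
apply/connected_intervalP/bigcup_connected.
  exists (rot (free2_eval (c r) (c s) w)) => -[f g] [/= rf rg].
  exists 1; rewrite /= ?in_itv /=; first by lra.
  by rewrite /path /= !rot_path_end rf rg.
move=> p _; apply: connected_continuous_connected; first exact: segment_connected.
apply: continuous_subspaceT => t.
by apply: lcvg_rot; apply: lcvg_free2_eval; exact: rot_path_continuous.
Qed.

End Paths.

(** * Lipschitz conjugation and compactness *)

Lemma sumr_const_seq (R : pzRingType) (I : Type) (s : seq I) (c : R) :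
  \sum_(i <- s) c = (size s)%:R * c.
Proof. by rewrite big_const_seq count_predT iter_addr_0 mulr_natl. Qed.

Section LipschitzConjugate.
Variables (R : realType) (S : seq (lift_homeo R)).
Implicit Types (phi : R -> R) (x y : R).
Let n : R := (size S)%:R.
Let n1 : 0 < n + 1. Proof. by rewrite ltr_wpDl. Qed.

(** A fixed point of this operator solves the equation wanted for the conjugating map. *)
Let avg phi x := (x + \sum_(s <- S) phi (s x)) / (n + 1).

(** This bounds the total displacement of [S], so that [x - D] lies below its image under [avg] and
    [x + D] above its own; iteration from [x - D] then increases and stays bounded. *)
Let D : R := \sum_(s <- S) (`|rot s| + 2).

Let D0 : 0 <= D. Proof. by apply: sumr_ge0 => s _; rewrite addr_ge0. Qed.

Let sum_displacement x : `|\sum_(s <- S) s x - n * x| <= D.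
Proof.
rewrite -sumr_const_seq -sumrB; apply: le_trans (ler_norm_sum _ _ _) _.
by apply: ler_sum => s _; exact: rot_displacement.
Qed.

Let avg_le phi psi : (forall x, phi x <= psi x) -> forall x, avg phi x <= avg psi x.
Proof.
move=> pp x; rewrite /avg ler_pM2r ?invr_gt0 // lerD2l.
by apply: ler_sum => s _.
Qed.

Let avg_shift c x :
  avg (fun y => y + c) x = (x + \sum_(s <- S) s x + n * c) / (n + 1).
Proof. by rewrite /avg big_split /= sumr_const_seq addrA. Qed.

Let it k := iter k avg (fun x => x - D).

Let it_ndecr x : nondecreasing_seq (it ^~ x).
Proof.
apply/nondecreasing_seqP => k; elim: k x => [|k IHk] x; last exact: avg_le.
rewrite /it /= avg_shift ler_pdivlMr //.
by have := sum_displacement x; rewrite ler_norml => /andP[? ?]; lra.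
Qed.

Let it_ub k x : it k x <= x + D.
Proof.
elim: k x => [|k IHk] x; first by rewrite /it /=; have := D0; lra.
apply: le_trans (avg_le IHk x) _; rewrite avg_shift ler_pdivrMr //.
by have := sum_displacement x; rewrite ler_norml => /andP[? ?]; lra.
Qed.

Let itS k x : it k.+1 x = (x + \sum_(s <- S) it k (s x)) / (n + 1).
Proof. by []. Qed.

Let it_mono k : {homo it k : x y / x <= y}.
Proof.
elim: k => [|k IHk] x y xy; first by rewrite /it /= lerD2r.
rewrite !itS ler_pM2r ?invr_gt0 // lerD //.
by apply: ler_sum => s _; apply: IHk; rewrite lift_mono.
Qed.

Let it1 k x : it k (x + 1) = it k x + 1.
Proof.
elim: k x => [|k IHk] x; first by rewrite /it /= addrAC.
rewrite !itS; under eq_bigr do rewrite lift_fun1 IHk.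
rewrite big_split /= sumr_const_seq -/n; field.
by rewrite gt_eqF.
Qed.

Let it_continuous k : continuous (it k).
Proof.
elim: k => [|k IHk] x.
  by apply: cvgB; [exact: cvg_id|exact: cvg_cst].
apply: cvgMl; apply: cvgD; first exact: cvg_id.
apply: cvg_big; first exact: add_continuous.
by move=> s _; apply: continuous_comp; [exact: lift_fun_continuous|exact: IHk].
Qed.

Let h x : R := limn (it ^~ x).

Let cvg_it x : it k x @[k --> \oo] --> h x.
Proof.
apply: nondecreasing_is_cvgn (it_ndecr x) _.
by exists (x + D) => _ [k _ <-]; exact: it_ub.
Qed.

Let h_fix x : h x = (x + \sum_(s <- S) h (s x)) / (n + 1).
Proof.
have hS := @cvg_it x; rewrite -cvg_shiftS in hS.
apply: cvg_unique hS _ => //.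
apply: cvgMl; apply: cvgD; first exact: cvg_cst.
by apply: cvg_big => [|s _]; [exact: add_continuous|exact: cvg_it].
Qed.

Let h_le : {homo h : x y / x <= y}.
Proof.
move=> x y xy; refine (ler_cvg_to (@cvg_it x) (@cvg_it y) _).
by apply: nearW => k; exact: it_mono.
Qed.

Let h1 x : h (x + 1) = h x + 1.
Proof.
have hx : it k (x + 1) @[k --> \oo] --> h x + 1.
  under eq_cvg do rewrite it1.
  by apply: cvgD; [exact: cvg_it|exact: cvg_cst].
exact: cvg_unique (@cvg_it _) hx.
Qed.

Let it_le_h k x : it k x <= h x.
Proof. exact: nondecreasing_cvgn_le (it_ndecr x) (cvgP _ (@cvg_it x)) k. Qed.

Let q : R := n / (n + 1).

(** The initial error is at most [2 * D], and each averaging multiplies it by [q], since [n] of the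
    [n + 1] terms carry an error. The bound is uniform in [x], so [h] inherits continuity from the
    iterates. *)
Let h_dist k x : `|h x - it k x| <= 2 * D * q ^+ k.
Proof.
rewrite ger0_norm ?subr_ge0 ?it_le_h //.
elim: k x => [|k IHk] x.
  rewrite expr0 mulr1 /it /=.
  have : h x <= x + D.
    refine (ler_cvg_to (@cvg_it x) (cvg_cst (x + D)) _).
    by apply: nearW => k; exact: it_ub.
  by lra.
rewrite h_fix itS -mulrBl opprD addrACA subrr add0r -sumrB ler_pdivrMr //.
have -> : 2 * D * q ^+ k.+1 * (n + 1) = n * (2 * D * q ^+ k).
  by rewrite exprS /q; field; rewrite gt_eqF.
by rewrite -sumr_const_seq; apply: ler_sum => s _.
Qed.

Let h_continuous : continuous h.
Proof.
move=> x; apply/cvgrPdist_lt => e e0.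
have q1 : `|q| < 1.
  by rewrite ger0_norm ?divr_ge0 ?ltr_pdivrMr // ?(ltW n1) // mul1r ltrDl.
have e3 : 0 < e / 3 by rewrite divr_gt0.
have /cvgrPdist_lt/(_ _ e3)[k _ /(_ k (leqnn k))] := cvg_geometric (2 * D) q1.
rewrite /= sub0r normrN => qk.
near=> y.
have : `|it k x - it k y| < e / 3.
  by near: y; exact: (cvgrPdist_lt _ _).1 (@it_continuous k x) _ e3.
have := h_dist k x; have := h_dist k y; have := ler_norm (2 * D * q ^+ k).
rewrite !ler_norml !ltr_norml => ? /andP[? ?] /andP[? ?] /andP[? ?].
by apply/andP; split; lra.
Unshelve. all: by end_near.
Qed.

(** The limit gives only weak monotonicity; strictness comes from the term [x] in the fixed-point
    equation. *)
Let h_lt : {homo h : x y / x < y}.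
Proof.
move=> x y xy; rewrite h_fix [ltRHS]h_fix ltr_pM2r ?invr_gt0 // ltr_leD //.
by apply: ler_sum => s _; apply: h_le; rewrite lift_mono ltW.
Qed.

(* The conjugating map solves [(1 + |S|) h = id + sum_(s in S) h o s], so the
   increments of [h] dominate those of every [h o s] up to the factor [1 + |S|]. *)
Lemma ex_lipschitz_conj : exists g : lift_homeo R, forall s, s \in S ->
  forall x y, x <= y ->
  (g * s * g^-1)%g y - (g * s * g^-1)%g x <= (size S).+1%:R * (y - x).
Proof.
have [g gE] := ex_lift_homeo h_continuous h_lt h1.
suff key s x y : s \in S -> x <= y ->
    g (s y) - g (s x) <= (size S).+1%:R * (g y - g x).
  exists g => s sS x y xy; have := key s ((g^-1)%g x) ((g^-1)%g y) sS.
  by rewrite lift_mono !lift_mulKV; exact.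
move=> sS xy; rewrite -natr1 -/n !gE [h y]h_fix [h x]h_fix -mulrBl mulrC.
rewrite divfK ?gt_eqF // opprD addrACA -sumrB.
have hs (t : lift_homeo R) : 0 <= h (t y) - h (t x).
  by rewrite subr_ge0; apply: h_le; rewrite lift_mono.
have -> : \sum_(t <- S) (h (t y) - h (t x)) =
    h (s y) - h (s x) + \sum_(t <- rem s S) (h (t y) - h (t x)).
  by rewrite (perm_big _ (perm_to_rem sS)) big_cons.
have := @sumr_ge0 R _ (rem s S) xpredT _ (fun t _ => hs t).
by lra.
Qed.

End LipschitzConjugate.

(** * Limits along ultrafilters and compactness of the set of values *)

Section Compactness.
Variable R : realType.
Implicit Types (f g h : lift_homeo R) (x y r s v : R) (w : free2).

(** The image filter has a cluster point in the compact segment, and a cluster point of an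
    ultrafilter is a limit. *)
Lemma ultra_bounded_cvg (T : Type) (F : set_system T) (phi : T -> R) (M : R) :
  UltraFilter F -> (forall t, `|phi t| <= M) ->
  exists l : R, phi t @[t --> F] --> l.
Proof.
move=> UF bphi.
have FM : (phi @ F) `[- M, M].
  by apply: (@filterE _ F) => t; rewrite /= in_itv /= -ler_norml.
have [l [_ cl]] := @segment_compact R (- M) M (phi @ F) _ FM.
exists l => N lN; have [//|FN] := in_ultra_setVsetC (phi @^-1` N) UF.
by have [y [/=]] := cl (~` N) N FN lN.
Qed.

(** Both bounds survive pointwise limits: the lower one keeps the limit strictly increasing, the
    upper one keeps it continuous. *)
Definition bilipschitz (k : R) f := forall x y, x <= y ->
  k^-1 * (y - x) <= f y - f x <= k * (y - x).

Lemma bilipschitz_ultra_cvg (T : Type) (F : set_system T)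
    (u : T -> lift_homeo R) (k r : R) :
  UltraFilter F -> 0 < k -> (forall t, bilipschitz k (u t)) ->
  (forall t, rot (u t) = r) -> exists f, lcvg (F := F) u f.
Proof.
move=> UF k0 ku ur; have PF : ProperFilter F by exact: ultra_proper.
(* The fixed rotation number bounds the displacement, so the values at [x] stay in a bounded set. *)
have lim_ex x : exists l : R, u t x @[t --> F] --> l.
  apply: (@ultra_bounded_cvg _ _ _ (`|x| + (`|r| + 2))) => t.
  rewrite -[X in `|X|](subrK x) addrC; apply: le_trans (ler_normD _ _) _.
  by rewrite lerD2l -(ur t) rot_displacement.
have [f uf] := choice lim_ex.
have kf x y : x <= y -> k^-1 * (y - x) <= f y - f x <= k * (y - x).
  move=> xy; have uxy : u t y - u t x @[t --> F] --> f y - f x.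
    by apply: cvgB; exact: uf.
  apply/andP; split; [apply: cvgr_to_ge uxy _|apply: cvgr_to_le uxy _];
    by apply: nearW => t; have /andP[] := ku t _ _ xy.
have f_lt : {homo f : x y / x < y}.
  move=> x y xy; rewrite -subr_gt0; have /andP[+ _] := kf _ _ (ltW xy).
  by apply: lt_le_trans; rewrite mulr_gt0 ?invr_gt0 ?subr_gt0.
have f1 x : f (x + 1) = f x + 1.
  have ux1 : u t (x + 1) @[t --> F] --> f x + 1.
    under eq_cvg do rewrite lift_fun1.
    by apply: cvgD; [exact: uf|exact: cvg_cst].
  exact: cvg_unique (uf _) ux1.
have f_cont : continuous f.
  have fk x y : `|f x - f y| <= k * `|x - y|.
    wlog xy : x y / x <= y.
      move=> H; have [/H//|/ltW/H] := leP x y.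
      by rewrite distrC [X in _ * X]distrC.
    have /andP[fl fr] := kf _ _ xy; rewrite distrC [X in _ * X]distrC.
    rewrite !ger0_norm ?subr_ge0 //; last exact: (ltW_homo f_lt).
  move=> x; apply/cvgrPdist_lt => e e0; near=> y.
  apply: le_lt_trans (fk _ _) _; rewrite mulrC -ltr_pdivlMr //.
  by near: y; apply: (cvgrPdist_lt _ _).1 cvg_id _ _; rewrite divr_gt0.
have [g gE] := ex_lift_homeo f_cont f_lt f1.
by exists g => x; rewrite gE; exact: uf.
Unshelve. all: by end_near.
Qed.

Lemma lcvg_rot_cst (T : Type) (F : set_system T) (FF : ProperFilter F)
    (u : T -> lift_homeo R) f r :
  lcvg (F := F) u f -> (forall t, rot (u t) = r) -> rot f = r.
Proof.
move=> /lcvg_rot uf ur; rewrite (funext ur : _ = cst r) in uf.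
exact: cvg_unique uf (cvg_cst _).
Qed.

Lemma free2_eval_conj f g h w :
  free2_eval (h * f * h^-1)%g (h * g * h^-1)%g w =
  (h * free2_eval f g w * h^-1)%g.
Proof.
rewrite /free2_eval; elim: (word w) => [|l u IHu] /=.
  by rewrite mulg1 mulgV.
rewrite IHu; suff -> : letter_eval (h * f * h^-1)%g (h * g * h^-1)%g l =
    (h * letter_eval f g l * h^-1)%g by rewrite !mulgA mulgVK.
by case: l => [[] []]; rewrite /letter_eval //= !invgM invgK !mulgA.
Qed.

(** Conjugating the generators together with their inverses makes four lifts, hence the constant 4 +
    1 = 5. The bound for an inverse is the lower bound for the generator. *)
Lemma rot_set_bilipschitz w r s v : rot_set w r s v ->
  exists f g, [/\ bilipschitz 5 f, bilipschitz 5 g &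
    [/\ rot f = r, rot g = s & rot (free2_eval f g w) = v]].
Proof.
move=> /rot_setP[f [g [rf rg vE]]].
have [h hL] := @ex_lipschitz_conj R [:: f; (f^-1)%g; g; (g^-1)%g].
have bil t : t \in [:: f; (f^-1)%g; g; (g^-1)%g] ->
    (t^-1)%g \in [:: f; (f^-1)%g; g; (g^-1)%g] ->
    bilipschitz 5 (h * t * h^-1)%g.
  move=> tS tVS x y xy; rewrite (hL t tS) // andbT.
  set t' := (h * t * h^-1)%g.
  have := hL _ tVS (t' x) (t' y).
  have -> : (h * t^-1 * h^-1)%g = (t'^-1)%g by rewrite /t' !invgM invgK mulgA.
  rewrite !lift_mulVK lift_mono => /(_ xy) /=; lra.
exists (h * f * h^-1)%g, (h * g * h^-1)%g; split.
- by apply: bil; rewrite !inE eqxx ?orbT.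
- by apply: bil; rewrite !inE eqxx ?orbT.
- by rewrite free2_eval_conj !rot_conj.
Qed.

Lemma rot_set_nonempty w r s : rot_set w r s !=set0.
Proof.
pose c r := lift_add 1%g (rot_shift 1%g r) : lift_homeo R.
exists (rot (free2_eval (c r) (c s) w)); apply/rot_setP.
by exists (c r), (c s); rewrite !rot_lift_add_shift.
Qed.

Lemma rot_set_compact w r s : compact (rot_set w r s).
Proof.
rewrite compact_ultra => U UU UX.
(* Outside the set, [p] takes generators of some other value, so the bounds and rotation numbers
   hold for every [v]. *)
have /choice[p pP] v : exists p : lift_homeo R * lift_homeo R,
    [/\ bilipschitz 5 p.1, bilipschitz 5 p.2, rot p.1 = r, rot p.2 = s &
      rot_set w r s v -> rot (free2_eval p.1 p.2 w) = v].
  have [X|nX] := pselect (rot_set w r s v).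
    by have [f [g [? ? [? ? ?]]]] := rot_set_bilipschitz X; exists (f, g).
  have [v' X] := rot_set_nonempty w r s.
  by have [f [g [? ? [? ? ?]]]] := rot_set_bilipschitz X; exists (f, g).
have [f pf] : exists f, lcvg (F := U) (fun v => (p v).1) f.
  by apply: (@bilipschitz_ultra_cvg _ _ _ 5 r) => // v; have [] := pP v.
have [g pg] : exists g, lcvg (F := U) (fun v => (p v).2) g.
  by apply: (@bilipschitz_ultra_cvg _ _ _ 5 s) => // v; have [] := pP v.
exists (rot (free2_eval f g w)); split.
  apply/rot_setP; exists f, g; split=> //.
    by apply: lcvg_rot_cst pf _ => v; have [] := pP v.
  by apply: lcvg_rot_cst pg _ => v; have [] := pP v.
have lim := lcvg_rot (lcvg_free2_eval (w := w) pf pg).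
(* On the set, which belongs to [U], the map from [v] to the rotation number given by [p v] is the
   identity; hence [U] itself converges. *)
move=> A /lim UA; apply: (@filterS2 _ U _ _ _ A _ UX UA) => v X /=.
by have [_ _ _ _ ->] := pP v.
Qed.

(** * Reflection, and the maximum and minimum *)

Fact ex_lift_flip f : exists g, forall x, g x = - f (- x).
Proof.
have [x|x y xy|x|g gE] := @ex_lift_homeo R (fun x => - f (- x)).
- apply: cvgN; apply: continuous_comp; first exact: continuousN.
  exact: lift_fun_continuous.
- by rewrite ltrN2 lift_monoS ltrN2.
- by have := lift_fun1 f (- x - 1); rewrite subrK opprD => ->; rewrite opprD addrNK.
- by exists g.
Qed.

Definition lift_flip f := projT1 (cid (ex_lift_flip f)).

Lemma lift_flipE f x : lift_flip f x = - f (- x).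
Proof. exact: (projT2 (cid (ex_lift_flip f))). Qed.

Lemma lift_flipM : {morph lift_flip : f g / (f * g)%g}.
Proof.
by move=> f g; apply: lift_homeoP => x; rewrite lift_mulE !lift_flipE opprK.
Qed.

Lemma lift_flip1 : lift_flip 1%g = 1%g.
Proof. by apply: (mulgI (lift_flip 1%g)); rewrite -lift_flipM !mulg1. Qed.

Lemma lift_flipV f : lift_flip (f^-1)%g = ((lift_flip f)^-1)%g.
Proof. by apply: (mulgI (lift_flip f)); rewrite -lift_flipM !mulgV lift_flip1. Qed.

(** Reflection fixes 0, so it negates the orbit of 0 term by term. *)
Lemma rot_flip f : rot (lift_flip f) = - rot f.
Proof.
have flip_iter : (fun n => (iter n (lift_flip f) 0 - 0) / n%:R) =
    (fun n => - ((iter n f 0 - 0) / n%:R)).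
  apply: funext => n; rewrite !subr0 -mulNr; congr (_ / _).
  by elim: n => [|n IHn] /=; rewrite ?oppr0 // IHn lift_flipE opprK.
have flip_cvg := @rot_cvg _ (lift_flip f) 0; rewrite flip_iter in flip_cvg.
exact: cvg_unique flip_cvg (cvgN (@rot_cvg _ f 0)).
Qed.

Lemma free2_eval_flip f g w :
  free2_eval (lift_flip f) (lift_flip g) w = lift_flip (free2_eval f g w).
Proof.
rewrite /free2_eval; elim: (word w) => [|l u IHu] /=; first by rewrite lift_flip1.
rewrite IHu lift_flipM; congr (_ * _)%g.
by case: l => [[] []] //; exact: esym (lift_flipV _).
Qed.

Lemma rot_set_opp w r s v : rot_set w r s v -> rot_set w (- r) (- s) (- v).
Proof.
move=> /rot_setP[f [g [<- <- <-]]]; apply/rot_setP.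
by exists (lift_flip f), (lift_flip g); split; rewrite ?free2_eval_flip rot_flip.
Qed.

(** Compactness makes the set bounded and closed, and the supremum lies in the closure. *)
Lemma rot_sup_max w r s :
  rot_set w r s (rot_sup w r s) /\ ubound (rot_set w r s) (rot_sup w r s).
Proof.
have cX := @rot_set_compact w r s.
have [M [_ bM]] := compact_bounded cX.
have ubX : has_ubound (rot_set w r s).
  exists (M + 1) => v Xv; apply: le_trans (ler_norm _) _.
  by apply: bM Xv; rewrite ltrDl.
split; last by move=> v Xv; apply: sup_upper_bound => //; split=> //; exists v.
apply: compact_closed cX _ _; first exact: Rhausdorff.
by apply: closure_sup => //; exact: rot_set_nonempty.
Qed.

End Compactness.

Theorem proposition2p16 (R : realType) (w : free2) (r s : R) :
  [/\ compact (rot_set w r s),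
      is_interval (rot_set w r s),
      rot_set w r s (rot_sup w r s) /\
        ubound (rot_set w r s) (rot_sup w r s) &
      rot_set w r s (- rot_sup w (- r) (- s)) /\
        lbound (rot_set w r s) (- rot_sup w (- r) (- s))].
Proof.
split.
- exact: rot_set_compact.
- exact: is_interval_rot_set.
- exact: rot_sup_max.
(* Negation carries the set for [- r] and [- s] into the one for [r] and [s] and back, turning the
   maximum into the minimum. *)
- have [maxX ubX] := rot_sup_max w (- r) (- s); split.
    by have := rot_set_opp maxX; rewrite !opprK.
  by move=> v /rot_set_opp /ubX; rewrite lerNl.
Qed.
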